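(* Let $f \in \mathbb{C}[x^{\pm1},y^{\pm1}]$ be a Laurent polynomial and let $\vec{v} \in \mathbb{Z}^2$ be a non-zero primitive vector. Then $f$ has a line polynomial factor in direction $\vec{v}$ if and only if the polynomials in $\mathcal{F}_{\vec{v}}(f)$ have a common factor, i.e. a common non-constant factor in $\mathbb{C}[t]$.
   Context: Write $X^{\vec{u}} = x^{u_1}y^{u_2}$ for $\vec{u}=(u_1,u_2)\in\mathbb{Z}^2$. The support of $f=\sum_{\vec u} f_{\vec u}X^{\vec u}$ is $\{\vec u : f_{\vec u}\neq 0\}$. A vector $\vec v \in \mathbb{Z}^2$ is primitive if its components are relatively prime. A line polynomial is a Laurent polynomial whose support has at least two points, all lying on a single line $\vec{u}+\mathbb{Q}\vec{v}$; it is then called a line polynomial in direction $\vec{v}$. The polynomial $f$ has a line polynomial factor in direction $\vec v$ if $f=\phi h$ for some line polynomial $\phi$ in direction $\vec v$ and some $h\in\mathbb{C}[x^{\pm1},y^{\pm1}]$. For primitive $\vec v$, every non-zero line polynomial in direction $\vec v$ can be written uniquely as $X^{\vec u}(a_0+a_1X^{\vec v}+\dots+a_nX^{n\vec v})$ with $n\ge 1$, $a_0\neq0$, $a_n\neq 0$. Its normal form is $a_0+a_1t+\dots+a_nt^n\in\mathbb{C}[t]$. The normal form of a monomial $aX^{\vec u}$ is $a$. A $\vec v$-fiber of $f$ is a polynomial $\sum_{k\in\mathbb{Z}} f_{\vec u+k\vec v}X^{\vec u+k\vec v}$ for some $\vec u\in\mathbb{Z}^2$. $\mathcal{F}_{\vec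 v}(f)$ denotes the finite set of distinct normal forms of all non-zero $\vec v$-fibers of $f$. *)

(* Defs.v *)
From HB Require Import structures.
From mathcomp Require Import all_boot all_order all_algebra.
From mathcomp Require Import finmap.
From mathcomp.multinomials Require Import monalg.
From mathcomp.real_closed Require Export complex.
From mathcomp Require Import boolp classical_sets.
From mathcomp Require Export reals.

Set Implicit Arguments.
Unset Strict Implicit.
Unset Printing Implicit Defensive.

Import GRing.Theory.
Local Open Scope fset_scope.
Local Open Scope ring_scope.

Notation Z2 := (int * int)%type.

(* K[x^{+-1}, y^{+-1}] as the group algebra of Z^2: [f@_u] is the coefficient
   of X^u, [msupp f] is the support of f and [<< a *g u >>] is the monomial
   a X^u.  The product of monalg does not apply here, since its monomials must
   not have non-trivial inverses, so it is defined below on an alias. *)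
Definition laurent (K : comNzRingType) : Type := {malg K[Z2]}.

HB.instance Definition _ (K : comNzRingType) :=
  GRing.Zmodule.on (laurent K).

Section LaurentRing.
Variable K : comNzRingType.
Implicit Types (f g h : laurent K) (u w : Z2) (a b : K).

Definition laurent_one : laurent K := << 1 *g (0 : Z2) >>.

Definition laurent_mul f g : laurent K :=
  \sum_(u <- msupp f) \sum_(w <- msupp g) << f@_u * g@_w *g u + w >>.

Lemma laurent_mulwE (d1 d2 : {fset Z2}) f g :
    msupp f `<=` d1 -> msupp g `<=` d2 ->
  laurent_mul f g =
    \sum_(u <- d1) \sum_(w <- d2) << f@_u * g@_w *g u + w >>.
Proof.
move=> le1 le2; rewrite /laurent_mul (big_fset_incl _ le1) /=.
  apply/eq_bigr => u _; apply/big_fset_incl => // w _ /mcoeff_outdom ->.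
  by rewrite mulr0 monalgU0.
move=> u _ /mcoeff_outdom fu.
by rewrite big1 // => w _; rewrite fu mul0r monalgU0.
Qed.

Lemma laurent_mulC : commutative laurent_mul.
Proof.
move=> f g; rewrite /laurent_mul exchange_big /=.
apply/eq_bigr => w _; apply/eq_bigr => u _.
by rewrite mulrC (addrC u).
Qed.

Lemma laurent_mul0f : left_zero 0 laurent_mul.
Proof. by move=> f; rewrite /laurent_mul msupp0 big_seq_fset0. Qed.

Lemma laurent_mulUU a b u w :
  laurent_mul << a *g u >> << b *g w >> = << a * b *g u + w >>.
Proof.
by rewrite (laurent_mulwE msuppU_le msuppU_le) !big_seq_fset1 !mcoeffUU.
Qed.

Lemma laurent_mul1f : left_id laurent_one laurent_mul.
Proof.
move=> f; rewrite (laurent_mulwE msuppU_le (fsubset_refl _)) big_seq_fset1.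
rewrite [RHS]monalgE; apply/eq_bigr => u _.
by rewrite mcoeffUU mul1r add0r.
Qed.

Lemma laurent_mulDl : left_distributive laurent_mul +%R.
Proof.
move=> f g h; have hh := fsubset_refl (msupp h).
rewrite (laurent_mulwE (msuppD_le f g) hh).
rewrite (laurent_mulwE (fsubsetUl _ (msupp g)) hh).
rewrite (laurent_mulwE (fsubsetUr (msupp f) _) hh).
rewrite -big_split /=; apply/eq_bigr => u _.
rewrite -big_split /=; apply/eq_bigr => w _.
by rewrite mcoeffD mulrDl monalgUD.
Qed.

Lemma laurent_mulDr : right_distributive laurent_mul +%R.
Proof. by move=> f g h; rewrite !(laurent_mulC f) laurent_mulDl. Qed.

Lemma laurent_mulf0 : right_zero 0 laurent_mul.
Proof. by move=> f; rewrite laurent_mulC laurent_mul0f. Qed.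

Lemma laurent_mulA : associative laurent_mul.
Proof.
have sl (I : Type) (r : seq I) (F : I -> laurent K) h :
    laurent_mul (\sum_(i <- r) F i) h = \sum_(i <- r) laurent_mul (F i) h.
  exact: (big_morph (laurent_mul^~ h)
            (fun f g => laurent_mulDl f g h) (laurent_mul0f h)).
have sr (I : Type) (r : seq I) (F : I -> laurent K) h :
    laurent_mul h (\sum_(i <- r) F i) = \sum_(i <- r) laurent_mul h (F i).
  by rewrite laurent_mulC sl; apply/eq_bigr => i _; rewrite laurent_mulC.
move=> f g h; move: laurent_mul laurent_mulUU sl sr => m mUU sl sr.
rewrite (monalgE f) !sl; apply: eq_bigr => u _.
rewrite (monalgE g) sl !sr sl; apply: eq_bigr => w _.
rewrite (monalgE h) !sr; apply: eq_bigr => z _.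
by rewrite !mUU mulrA addrA.
Qed.

Lemma laurent_one_neq0 : laurent_one != 0.
Proof. by rewrite monalgU_eq0 oner_neq0. Qed.

HB.instance Definition _ := GRing.Zmodule_isComNzRing.Build (laurent K)
  laurent_mulA laurent_mulC laurent_mul1f laurent_mulDl laurent_one_neq0.

End LaurentRing.

Section LinePolynomials.
Variable K : fieldType.
Implicit Types (f g phi h : laurent K) (u v w : Z2) (p : {poly K}).

Definition primitive v := coprimez v.1 v.2.

Definition on_Qline u v w : Prop :=
  exists q : rat, w.1%:Q = u.1%:Q + q * v.1%:Q /\ w.2%:Q = u.2%:Q + q * v.2%:Q.

Definition line_polynomial v phi : Prop :=
  (2 <= #|` msupp phi|)%N /\
  exists u, forall w, w \in msupp phi -> on_Qline u v w.

Definition has_line_factor v f : Prop :=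
  exists phi h, line_polynomial v phi /\ f = phi * h.

Definition fiber v f u : laurent K :=
  \sum_(w <- msupp f | `[< exists k : int, w = u + v *~ k >]) << f@_w *g w >>.

(* p is the normal form of g, for g a monomial (size p = 1) or a line
   polynomial in the primitive direction v (size p > 1).  The leading
   coefficient p`_(size p).-1 is non-zero by construction of {poly K}. *)
Definition normal_form v g p : Prop :=
  p`_0 != 0 /\
  exists u, g = \sum_(i < size p) << p`_i *g u + v *+ i >>.

Definition fiber_normal_forms v f : set {poly K} :=
  [set p | exists u, fiber v f u != 0 /\ normal_form v (fiber v f u) p]%classic.

(* The empty set, which is [fiber_normal_forms v 0], has a common factor. *)
Definition has_common_factor (F : set {poly K}) : Prop :=
  exists d : {poly K}, (1 < size d)%N /\ forall p, F p -> d %| p.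

End LinePolynomials.

(* Main.v *)
(* Since v is primitive, the points of a line in direction v lie on one coset of
   Z v, so a line polynomial is X^z d(X^v) with d_0 <> 0 and deg d >= 1.
   Multiplication by a polynomial supported on a coset of Z v maps fibers to
   fibers.  Hence if f = X^z d(X^v) h, every fiber of f is d(X^v) times a fiber
   of h, up to a monomial, and d divides every normal form, being prime to t.
   Conversely, a common factor d of the normal forms gives a common factor
   d(X^v) of all fibers, hence of their sum f; and d_0 <> 0 because normal forms
   have a non-zero constant term. *)

Require Import Defs.
From HB Require Import structures.
From mathcomp Require Import all_boot all_order all_algebra.
From mathcomp Require Import finmap ring.
From mathcomp.multinomials Require Import monalg.
From mathcomp Require Import boolp.

Set Implicit Arguments.
Unset Strict Implicit.
Unset Printing Implicit Defensive.

Import GRing.Theory.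
Local Open Scope fset_scope.
Local Open Scope ring_scope.

(** * Cosets of the line Z v in Z^2 *)

Section Lattice.
Implicit Types u v w : Z2.

(** This is the condition that selects the monomials of [fiber v f u]. *)
Definition coset v u w : Prop := exists k : int, w = u + v *~ k.

Lemma coset_refl v u : coset v u u.
Proof. by exists 0; rewrite mulr0z addr0. Qed.

(** An equality of propositions, so that it rewrites inside the boolean test of [fiberE]. *)
Lemma coset_shift v u w k : coset v (u + v *~ k) w = coset v u w.
Proof.
apply/propext; split=> -[j ->]; first by exists (k + j); rewrite mulrzDr addrA.
by exists (j - k); rewrite -addrA -mulrzDr subrKC.
Qed.

Lemma coset_subr v a u w : coset v (u - a) (w - a) = coset v u w.
Proof.
by apply/propext; split=> -[k e]; exists k; [apply: (addIr (- a))|];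
  rewrite ?e addrAC.
Qed.

Lemma mulrz_pair u k : u *~ k = (u.1 * k, u.2 * k).
Proof.
have E n : u *+ n = (u.1 * n%:Z, u.2 * n%:Z).
  elim: n => [|n IHn]; first by rewrite mulr0n !mulr0.
  by rewrite mulrS IHn -addn1 PoszD !mulrDr !mulr1 addrC.
case: k => n; first exact: E.
by rewrite NegzE mulrNz -pmulrn E !mulrN.
Qed.

Lemma mulrz_pair_inj v : v <> 0 -> injective (fun k : int => v *~ k).
Proof.
move=> v0 j k; rewrite !mulrz_pair => -[e1 e2].
have [x0|/mulfI inj] := eqVneq v.1 0; last exact: inj.
have [y0|/mulfI inj] := eqVneq v.2 0; last exact: inj.
by case: v0; case: v x0 y0 {e1 e2} => x y /= -> ->.
Qed.

(** The displacement [w - w0] is parallel to [v], so its determinant with [v] vanishes. With a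
    Bezout relation a v.1 + b v.2 = 1, the rational multiple of [v] is the integer obtained by
    applying (a, b) to [w - w0]. *)
Lemma on_Qline_coset v u w0 w :
  primitive v -> on_Qline u v w0 -> on_Qline u v w -> coset v w0 w.
Proof.
move=> v_prim [q0 [x0 y0]] [q [x y]].
have det0 : (w.1 - w0.1) * v.2 = (w.2 - w0.2) * v.1.
  apply: (@intr_inj rat).
  by rewrite !rmorphM !rmorphB /= x0 y0 x y; ring.
have [a [b ab]] := Bezoutz v.1 v.2.
have {}ab : a * v.1 + b * v.2 = 1.
  by rewrite ab; apply/eqP: v_prim.
exists (a * (w.1 - w0.1) + b * (w.2 - w0.2)).
rewrite mulrz_pair [LHS]surjective_pairing.
rewrite [w0 in RHS]surjective_pairing.
congr (_, _) => /=.
(* Insert the Bezout form of 1, then exchange coordinates by [det0]. *)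
- transitivity (w0.1 + (w.1 - w0.1) * (a * v.1 + b * v.2)).
    by rewrite ab; ring.
  by rewrite mulrDr (mulrCA _ b) det0; ring.
- transitivity (w0.2 + (w.2 - w0.2) * (a * v.1 + b * v.2)).
    by rewrite ab; ring.
  by rewrite mulrDr (mulrCA _ a) -det0; ring.
Qed.

End Lattice.

(* Locked, as is [line_eval] below, so that unification does not unfold
   products of monomials. *)
HB.lock Definition monom (K : fieldType) (a : K) (u : Z2) : laurent K :=
  << a *g u >>.
Canonical monom_unlockable := Unlockable monom.unlock.

(** * Coefficients and multiplication by monomials *)

Section Coefficients.
Variable K : fieldType.
Implicit Types (f g h : laurent K) (u v w : Z2) (a b : K) (p q d : {poly K}).

Local Notation monom := (@monom K).

Lemma lcoef_monom a u w : (monom a u)@_w = a *+ (u == w).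
Proof. by rewrite unlock mcoeffU. Qed.

Lemma laurentP f g : (forall u, f@_u = g@_u) -> f = g.
Proof. by move/malgP. Qed.

Lemma laurentE f : f = \sum_(u <- msupp f) monom f@_u u.
Proof.
rewrite [LHS](monalgE (f : {malg K[Z2]})).
by apply: eq_bigr => u _; rewrite unlock.
Qed.

Lemma msupp_neq0 f : f != 0 -> exists u, u \in msupp f.
Proof.
move=> f0; apply/fset0Pn; apply: contra f0 => /eqP f0.
by rewrite [f]laurentE f0 big_seq_fset0.
Qed.

Lemma lcoef0 u : (0 : laurent K)@_u = 0.
Proof. exact: mcoeff0. Qed.

Lemma lcoefD f g u : (f + g)@_u = f@_u + g@_u.
Proof. exact: mcoeffD. Qed.

Lemma lcoefB f g u : (f - g)@_u = f@_u - g@_u.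
Proof. exact: mcoeffB. Qed.

Lemma lcoef_sum (I : Type) (r : seq I) (P : pred I) (F : I -> laurent K) u :
  (\sum_(i <- r | P i) F i)@_u = \sum_(i <- r | P i) (F i)@_u.
Proof. exact: (big_morph _ (fun f g => lcoefD f g u) (lcoef0 u)). Qed.

Lemma monomM a b u w : monom a u * monom b w = monom (a * b) (u + w).
Proof. by rewrite unlock; apply: laurent_mulUU. Qed.

Lemma monom1_0 : monom 1 0 = 1.
Proof. by rewrite unlock. Qed.

Lemma monom1M u w f : monom 1 u * (monom 1 w * f) = monom 1 (u + w) * f.
Proof. by rewrite mulrA monomM mulr1. Qed.

Lemma monom1M_shift u w z f g : monom 1 w * f = monom 1 u * g ->
  monom 1 (w + z) * f = monom 1 u * (monom 1 z * g).
Proof. by rewrite addrC -monom1M => ->; rewrite mulrCA. Qed.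

Lemma monomK u f : monom 1 (- u) * (monom 1 u * f) = f.
Proof. by rewrite mulrA monomM mulr1 addNr monom1_0 mul1r. Qed.

Lemma monomVK u f : monom 1 u * (monom 1 (- u) * f) = f.
Proof. by rewrite -{1}(opprK u) monomK. Qed.

Lemma lcoef_monomM a u f w : (monom a u * f)@_w = a * f@_(w - u).
Proof.
rewrite [f in LHS]laurentE mulr_sumr lcoef_sum.
rewrite [f in RHS]laurentE lcoef_sum mulr_sumr; apply: eq_bigr => z _.
rewrite monomM !lcoef_monom mulrnAr; congr (_ *+ nat_of_bool _).
by rewrite [RHS]eq_sym subr_eq eq_sym addrC.
Qed.

Lemma monom_is_additive : zmod_morphism (fun a => monom a 0).
Proof. by move=> a b; rewrite unlock; apply: monalgUB. Qed.

Lemma monom_is_monoid : monoid_morphism (fun a => monom a 0).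
Proof. by split=> [|a b]; rewrite ?monomM ?addr0 ?monom1_0. Qed.

(** The embedding of scalars; its ring morphism structure makes [line_eval] additive and
    multiplicative. *)
Definition lconst a := monom a 0.

HB.instance Definition _ :=
  GRing.isZmodMorphism.Build K (laurent K) lconst monom_is_additive.
HB.instance Definition _ :=
  GRing.isMonoidMorphism.Build K (laurent K) lconst monom_is_monoid.

End Coefficients.

(** * Substitution of X^v for t *)

HB.lock Definition line_eval (K : fieldType) (v : Z2) (p : {poly K}) :
  laurent K := (map_poly (@lconst K) p).[monom 1 v].
Canonical line_eval_unlockable := Unlockable line_eval.unlock.

Section LineFactors.
Variable K : fieldType.
Implicit Types (f g h : laurent K) (u v w : Z2) (a b : K) (p q d : {poly K}).

Local Notation monom := (@monom K).
Local Notation line_eval := (@line_eval K).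

Lemma monomXn v n : monom 1 v ^+ n = monom 1 (v *+ n).
Proof.
elim: n => [|n IHn]; first by rewrite expr0 mulr0n monom1_0.
by rewrite exprS IHn monomM mulr1 mulrS.
Qed.

Lemma line_evalE v p : line_eval v p = \sum_(i < size p) monom p`_i (v *+ i).
Proof.
rewrite unlock (@horner_coef_wide _ (size p)) ?size_map_poly //.
apply: eq_bigr => i _; rewrite coef_map monomXn.
by rewrite /lconst /= monomM mulr1 add0r.
Qed.

Lemma line_evalD v p q : line_eval v (p + q) = line_eval v p + line_eval v q.
Proof. by rewrite unlock rmorphD hornerD. Qed.

Lemma line_evalM v p q : line_eval v (p * q) = line_eval v p * line_eval v q.
Proof. by rewrite unlock rmorphM hornerM. Qed.

Lemma line_evalC v a : line_eval v a%:P = monom a 0.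
Proof. by rewrite unlock map_polyC hornerC. Qed.

Lemma line_evalXn v n : line_eval v 'X^n = monom 1 (v *+ n).
Proof. by rewrite unlock map_polyXn hornerXn monomXn. Qed.

(** For non-zero [v] the multiples of [v] are pairwise distinct, so no two terms of [p] are
    merged. *)
Lemma lcoef_line_eval v p i : v <> 0 -> (line_eval v p)@_(v *+ i) = p`_i.
Proof.
move=> v0; rewrite line_evalE lcoef_sum.
under eq_bigr => j _.
  rewrite lcoef_monom (_ : (v *+ j == v *+ i) = (j == i :> nat)); first over.
  apply/eqP/eqP=> [|-> //]; rewrite !pmulrn.
  by move/(mulrz_pair_inj v0) => [].
have [i_lt|i_ge] := ltnP i (size p).
  rewrite (bigD1 (Ordinal i_lt)) //= eqxx big1 ?addr0 // => j /negPf.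
  by rewrite -val_eqE /= => ->.
rewrite nth_default // big1 // => j _.
by rewrite (ltn_eqF (leq_trans (ltn_ord j) i_ge)).
Qed.

Lemma line_eval_inj v : v <> 0 -> injective (line_eval v).
Proof.
by move=> v0 p q e; apply/polyP=> i; rewrite -!(lcoef_line_eval _ _ v0) e.
Qed.

Lemma line_eval0 v : line_eval v 0 = 0.
Proof. by rewrite unlock rmorph0 horner0. Qed.

(** * Fibers and their behaviour under products *)

Lemma fiberE v f u w :
  (fiber v f u)@_w = if `[< coset v u w >] then f@_w else 0.
Proof.
rewrite /fiber lcoef_sum [f in RHS]laurentE lcoef_sum.
case: ifPn => /asboolP cw.
  rewrite big_mkcond; apply: eq_bigr => z _.
  rewrite lcoef_monom; case: asboolP => cz; first by rewrite mcoeffU.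
  by case: eqP => [zw|_]; [case: cz; rewrite zw|rewrite mulr0n].
apply: big1 => z /asboolP cz; rewrite mcoeffU.
by case: eqP => [zw|_]; [case: cw; rewrite -zw|rewrite mulr0n].
Qed.

Lemma fiber_supp v f u w : w \in msupp (fiber v f u) -> coset v u w.
Proof. by rewrite -mcoeff_neq0 fiberE; case: asboolP => //; rewrite eqxx. Qed.

Lemma fiber0 v u : fiber v 0 u = 0 :> laurent K.
Proof. by apply: laurentP => w; rewrite fiberE !lcoef0 if_same. Qed.

Lemma fiberD v f g u : fiber v (f + g) u = fiber v f u + fiber v g u.
Proof.
apply: laurentP => w; rewrite [LHS]fiberE 2!lcoefD (fiberE v f) (fiberE v g).
by case: ifP => //; rewrite addr0.
Qed.

Lemma fiber_sum (I : Type) (r : seq I) (F : I -> laurent K) v u :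
  fiber v (\sum_(i <- r) F i) u = \sum_(i <- r) fiber v (F i) u.
Proof. exact: (big_morph _ (fun g h => fiberD v g h u) (fiber0 v u)). Qed.

Lemma fiber_shift v f u k : fiber v f (u + v *~ k) = fiber v f u.
Proof. by apply: laurentP => w; rewrite !fiberE coset_shift. Qed.

Lemma fiber_monomM v a z f u :
  fiber v (monom a z * f) u = monom a z * fiber v f (u - z).
Proof.
apply: laurentP => w; rewrite [RHS]lcoef_monomM [LHS]fiberE.
rewrite lcoef_monomM fiberE coset_subr.
by case: ifP; rewrite ?mulr0.
Qed.

(** Each monomial of [phi] translates by [z] plus a multiple of [v], and a fiber of [f] does not see
    that multiple; all terms of [phi] thus multiply the same fiber. *)
Lemma fiberM v (phi : laurent K) f z u :
    (forall w, w \in msupp phi -> coset v z w) ->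
  fiber v (phi * f) u = phi * fiber v f (u - z).
Proof.
move=> phi_line; rewrite [phi]laurentE !mulr_suml fiber_sum !big_seq.
apply: eq_bigr => w /phi_line [k ->].
by rewrite fiber_monomM opprD addrA -mulrNz fiber_shift.
Qed.

(** * Polynomials supported on one coset, and normal forms *)

Lemma line_eval_exists v g u : (forall w, w \in msupp g -> coset v u w) ->
  exists z q, g = monom 1 z * line_eval v q.
Proof.
(* Exponents relative to [u] may be negative. Clearing them by a power of X^v gives a property
   closed under sums, which needs checking on monomials only. *)
pose P g := exists n q, monom 1 (v *+ n) * g = monom 1 u * line_eval v q.
move=> g_line; suff [n [q e]] : P g.
  exists (- (v *+ n) + u), q.
  by move: (v *+ n) e => w e; rewrite -(monomK w g) {}e monom1M.
rewrite [g]laurentE big_seq; elim/big_ind: _ => [|f h [n [q e]] [m [r e']]|w].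
- by exists 0%N, 0; rewrite line_eval0 !mulr0.
(* Common denominator of the two summands. *)
- exists (n + m)%N, ('X^m * q + 'X^n * r).
  rewrite line_evalD !line_evalM !line_evalXn !mulrDr mulrnDr.
  move: (v *+ n) (v *+ m) e e' => w z e e'.
  rewrite (monom1M_shift z e) (addrC w) (monom1M_shift w e').
  reflexivity.
- move/g_line; move: (g@_w) => a [[n|n] ->].
    exists 0%N, (a%:P * 'X^n).
    rewrite line_evalM line_evalC line_evalXn !monomM.
    by rewrite mulr0n !add0r !(mul1r, mulr1) pmulrn.
  (* Here the exponent is -(n + 1), which [n.+1] cancels exactly. *)
  exists n.+1, a%:P.
  rewrite line_evalC !monomM addr0 NegzE mulrNz -pmulrn.
  by rewrite addrCA addrN addr0.
Qed.

Lemma normal_form_exists v g u :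
    g != 0 -> (forall w, w \in msupp g -> coset v u w) ->
  exists z p, p`_0 != 0 /\ g = monom 1 z * line_eval v p.
Proof.
move=> g0 /line_eval_exists[z [q e]].
have q0 : q != 0 by apply: contraNneq g0 => q0; rewrite e q0 line_eval0 mulr0.
(* Move the largest power of t dividing [q] into the monomial; the remaining [p] does not vanish at
   0. *)
have [m [p]] := multiplicity_XsubC q 0; rewrite q0 /= subr0 => p0 eq.
exists (z + v *+ m), p; split; first by rewrite -horner_coef0.
by rewrite {}e eq line_evalM line_evalXn mulrCA monomM mulr1 mulrC.
Qed.

Lemma normal_formE v g p :
  normal_form v g p <-> p`_0 != 0 /\ exists u, g = monom 1 u * line_eval v p.
Proof.
have E u : monom 1 u * line_eval v p
           = \sum_(i < size p) << p`_i *g u + v *+ i >>.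
  rewrite line_evalE mulr_sumr; apply: eq_bigr => i _.
  by rewrite monomM mul1r unlock.
by split=> -[p0 [u ->]]; split=> //; exists u; rewrite E.
Qed.

Lemma monom_line_eval_supp v z p w :
  w \in msupp (monom 1 z * line_eval v p) -> coset v z w.
Proof.
rewrite -mcoeff_neq0 lcoef_monomM mul1r line_evalE lcoef_sum => nz.
have [[i e]|no] := pselect (exists i : 'I_(size p), v *+ i = w - z).
  by exists i; rewrite -pmulrn e addrC subrK.
case/eqP: nz; apply: big1 => i _; rewrite lcoef_monom.
by case: eqP => [e|_]; [case: no; exists i|rewrite mulr0n].
Qed.

(* Two presentations of the same fiber differ by a power of X^v, which is a
   unit; over K[t] this only costs a power of t, and t is prime to d. *)
Lemma dvdp_normal_form v z y p d q :
    v <> 0 -> p`_0 != 0 -> d`_0 != 0 ->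
    monom 1 z * line_eval v p = monom 1 y * line_eval v (d * q) ->
  d %| p.
Proof.
move=> v0 p0 d0 e.
(* The coefficient at [z] on the left is the constant term of [p], hence non-zero, so [z] is in the
   support of the right-hand side. *)
have [k zk] : coset v y z.
  apply: (@monom_line_eval_supp _ _ (d * q)); rewrite -e -mcoeff_neq0.
  by rewrite lcoef_monomM subrr mul1r -(mulr0n v) lcoef_line_eval.
move: e; rewrite {}zk -monom1M => /(can_inj (monomK y)).
have d_copX n : coprimep d 'X^n.
  by rewrite coprimep_expr // coprimepX rootE horner_coef0.
case: k => n.
  rewrite -pmulrn -line_evalXn -line_evalM => /(line_eval_inj v0) e.
  by rewrite -(Gauss_dvdpr _ (d_copX n)) e dvdp_mulIl.
rewrite NegzE mulrNz -pmulrn => e.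
suff -> : p = d * ('X^(n.+1) * q) by rewrite dvdp_mulIl.
apply: (line_eval_inj v0); rewrite mulrCA line_evalM line_evalXn -e.
by rewrite monomVK.
Qed.

(** * Line polynomials as X^z d(X^v) *)

Lemma line_polynomialP v (phi : laurent K) : v <> 0 -> primitive v ->
  line_polynomial v phi <->
  exists z d, [/\ d`_0 != 0, (1 < size d)%N & phi = monom 1 z * line_eval v d].
Proof.
move=> v0 v_prim; split=> [[card2 [u phi_line]]|[z [d [d0 sd ->]]]].
  have [w0 w0phi] : exists w0, w0 \in msupp phi.
    by apply/fset0Pn; rewrite -cardfs_gt0 (leq_trans _ card2).
  have phi_coset w : w \in msupp phi -> coset v w0 w.
    by move=> wphi; apply: on_Qline_coset (phi_line _ _) (phi_line _ _).
  have phi0 : phi != 0.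
    by apply: contraTneq w0phi => ->; rewrite msupp0 inE.
  have [z [d [d0 e]]] := normal_form_exists phi0 phi_coset.
  (* A constant [d] would leave at most one point in the support. *)
  exists z, d; split=> //; rewrite ltnNge; apply/negP => /size1_polyC dC.
  move: card2; rewrite e dC line_evalC monomM ltnNge => /negP; apply.
  by rewrite -(cardfs1 (z + 0)) unlock; apply/fsubset_leq_card/msuppU_le.
split; last first.
  exists z => w /monom_line_eval_supp [k ->]; exists k%:~R.
  by rewrite mulrz_pair /= !rmorphD !rmorphM /= !(mulrC k%:~R).
have mem i : d`_i != 0 -> z + v *+ i \in msupp (monom 1 z * line_eval v d).
  move=> di; rewrite -mcoeff_neq0 lcoef_monomM mul1r addrC addKr.
  by rewrite lcoef_line_eval.
have ne : z + v *+ 0 != z + v *+ (size d).-1.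
  rewrite (inj_eq (addrI z)) !pmulrn (inj_eq (mulrz_pair_inj v0)).
  by case: (size d) sd => [|[]].
(* The constant and leading terms of [d] give two distinct support points. *)
pose ends := [fset z + v *+ 0; z + v *+ (size d).-1].
apply: (@leq_trans #|` ends|); first by rewrite cardfs2 ne.
apply/fsubset_leq_card/fsubsetP => w; rewrite !inE => /orP[]/eqP->;
  apply: mem => //.
by rewrite -[d`__]/(lead_coef d) lead_coef_eq0 -size_poly_gt0 ltnW.
Qed.

(** * From divisibility of all fibers to divisibility of their sum *)

Lemma fiber_sub_fiber v f u w : coset v u w -> fiber v (f - fiber v f u) w = 0.
Proof.
case=> k ->; rewrite fiber_shift; apply: laurentP => z.
by rewrite fiberE lcoefB fiberE lcoef0; case: asboolP; rewrite ?subrr.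
Qed.

Lemma fiber_sub_fiberN v f u w :
  ~ coset v u w -> fiber v (f - fiber v f u) w = fiber v f w.
Proof.
move=> nuw; apply: laurentP => z; rewrite [LHS]fiberE lcoefB !fiberE.
case: asboolP => // -[k zw]; case: asboolP => [[j zu]|_]; last exact: subr0.
case: nuw; exists (j - k); apply: (addIr (v *~ k)).
by rewrite -zw zu -addrA -mulrzDr subrK.
Qed.

(* Removing one fiber from f leaves the other fibers unchanged. *)
Lemma dvd_fibers v (phi : laurent K) f :
  (forall u, exists h, fiber v f u = phi * h) -> exists h, f = phi * h.
Proof.
have [n] := ubnP #|` msupp f|; elim: n f => // n IHn f le_n phi_dvd.
have [->|f0] := eqVneq f 0; first by exists 0; rewrite mulr0.
have [u uf] := msupp_neq0 f0.
have [h1 e1] := phi_dvd u.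
have [||h2 e2] := IHn (f - fiber v f u).
(* The induction is on the size of the support: subtracting the fiber through [u] adds no point and
   removes at least [u]. *)
- rewrite -ltnS (leq_trans _ le_n) // ltnS (cardfsD1 u (msupp f)) uf ltnS.
  apply/fsubset_leq_card/fsubsetP => w; rewrite !inE -!mcoeff_neq0.
  rewrite lcoefB fiberE; case: asboolP => [_|ncw]; first by rewrite subrr eqxx.
  rewrite subr0 => ->; rewrite andbT; apply: contra_notN ncw => /eqP->.
  exact: coset_refl.
- move=> w; have [cw|ncw] := pselect (coset v u w).
    by exists 0; rewrite mulr0 fiber_sub_fiber.
  by rewrite fiber_sub_fiberN.
by exists (h2 + h1); rewrite mulrDr -e2 -e1 subrK.
Qed.

(** * The equivalence over an arbitrary field *)

Lemma line_factor_common_factor v f : v <> 0 -> primitive v ->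
  has_line_factor v f <-> has_common_factor (fiber_normal_forms v f).
Proof.
move=> v0 v_prim; split=> [[phi [h [phi_line ->]]]|[d [sd d_dvd]]].
  have [z [d [d0 sd e]]] := (line_polynomialP phi v0 v_prim).1 phi_line.
  exists d; split=> // p [u [_ /normal_formE[p0 [y ep]]]].
  have phi_supp w : w \in msupp phi -> coset v z w.
    by rewrite e => /monom_line_eval_supp.
  (* With the fiber of [h] written as X^y' q(X^v), the fiber of the product is both X^y p(X^v) and
     X^(z+y') (d q)(X^v). *)
  have [y' [q eq]] := line_eval_exists (@fiber_supp v h (u - z)).
  apply: (@dvdp_normal_form v y (z + y') p d q v0 p0 d0).
  rewrite -{}ep (fiberM _ _ phi_supp) {}e {}eq line_evalM mulrACA monomM.
  by rewrite mulr1.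
(* For [f = 0] there are no normal forms and [d] may vanish at 0; the line polynomial 1 + X^v with
   cofactor 0 is taken instead. *)
have [->|f0] := eqVneq f 0.
  exists (line_eval v ('X + 1)), 0; split; last by rewrite mulr0.
  apply/line_polynomialP=> //; exists 0, ('X + 1); split.
  - by rewrite coefD coefX coef1 add0r oner_eq0.
  - by rewrite -[1]/(1%:P) size_XaddC.
  - by rewrite monom1_0 mul1r.
have fib u : exists h, fiber v f u = line_eval v d * h.
  have [->|fu0] := eqVneq (fiber v f u) 0; first by exists 0; rewrite mulr0.
  have [z [p [p0 e]]] := normal_form_exists fu0 (@fiber_supp v f u).
  have /d_dvd/dvdpP[q pq] : fiber_normal_forms v f p.
    by exists u; split=> //; apply/normal_formE; split=> //; exists z.
  exists (monom 1 z * line_eval v q).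
  by rewrite {}e pq line_evalM mulrA mulrC.
(* A support point of [f] yields a non-zero fiber. Its normal form is a multiple of [d] with
   non-zero constant term, so the constant term of [d] is non-zero too. *)
have [u uf] := msupp_neq0 f0.
have fu0 : fiber v f u != 0.
  apply: contraTneq uf => fu0.
  have := fiberE v f u u; rewrite fu0 lcoef0 (asboolT (coset_refl v u)).
  by rewrite -mcoeff_neq0 => <-; rewrite eqxx.
have [z [p [p0 e]]] := normal_form_exists fu0 (@fiber_supp v f u).
have /d_dvd/dvdpP[q pq] : fiber_normal_forms v f p.
  by exists u; split=> //; apply/normal_formE; split=> //; exists z.
have d0 : d`_0 != 0.
  apply: contraNneq p0; rewrite pq -!horner_coef0 hornerM => ->.
  by rewrite mulr0.
have [h fh] := dvd_fibers fib.
exists (line_eval v d), h; split; last exact: fh.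
apply/(line_polynomialP _ v0 v_prim); exists 0, d.
by rewrite monom1_0 mul1r; exact: And3 d0 sd erefl.
Qed.

End LineFactors.

Theorem theorem5 (R : realType) (f : laurent R[i]) (v : int * int)
    (v_neq0 : v <> 0) (v_prim : primitive v) :
  has_line_factor v f <-> has_common_factor (fiber_normal_forms v f).
Proof. exact: line_factor_common_factor. Qed.
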